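(* Let $\Omega$ be either $\mathbb{R}\times\mathbb{R}$ (band type) or $\mathbb{R}\times S^1$ (annulus type), and let $X:\Omega\to H_1$ be a $C^2$ smooth immersion whose image $\Sigma=X(\Omega)$ is a p-minimal surface and whose first parameter describes the rulings of $\Sigma$. Let $\tilde\Gamma_t$ denote the ruling with second parameter $t$, and let $r_t$ be the (Euclidean) distance from $\tilde\Gamma_t$ to the origin $O$. (1) If $\Omega=\mathbb{R}\times S^1$ and $\Sigma$ is complete, then $\Sigma$ is proper. (2) If $\Omega=\mathbb{R}\times\mathbb{R}$ and $\Sigma$ is complete, then $\Sigma$ is proper if and only if $\lim_{t\to\pm\infty}r_t=+\infty$ (i.e. both limits are $+\infty$).
   Context: The Heisenberg group $H_1$ is identified with $\mathbb{R}^3$ (coordinates $x,y,z$), with contact form $\Theta=dz+x\,dy-y\,dx$. For a $C^2$ (immersed) surface $\Sigma$ in $H_1$, a point $p$ is singular if $T_p\Sigma=\ker\Theta_p$. On the nonsingular part, $T\Sigma\cap\ker\Theta$ is a line field, whose integral curves are called characteristic curves. $\Sigma$ is p-minimal if its p-mean curvature vanishes at all nonsingular points, i.e. the $xy$-projections of the characteristic curves have zero curvature; for a graph $z=u(x,y)$ this is the equation $\mathrm{div}\big((\nabla u+\vec F)/|\nabla u+\vec F|\big)=0$, $\vec F=(-y,x)$, where $\nabla u+\vec F\ne0$. The characteristic curves of a p-minimal surface are pieces of Legendrian straight lines (lines along which $\Theta$ vanishes), and these lines are the rulings of $\Sigma$. That the first parameter describes the rulings means: for each fixed $t$, the curve $s\mapsto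 X(s,t)$ parametrizes the ruling $\tilde\Gamma_t=X(\mathbb{R}\times\{t\})$. $\Sigma$ is proper if $X$ is proper, i.e. $X^{-1}(K\cap\Sigma)$ is compact for every compact $K\subset H_1$. $\Sigma$ is complete if it (that is, $\Omega$ with the pulled-back metric) is complete with respect to the metric induced from the standard Euclidean metric of $\mathbb{R}^3$. *)

(* Defs.v *)
From HB Require Import structures.
From mathcomp Require Import all_boot all_order all_algebra.
From mathcomp Require Import all_classical all_reals all_analysis.

Set Implicit Arguments.
Unset Strict Implicit.
Unset Printing Implicit Defensive.

Import Order.TTheory GRing.Theory Num.Theory.
Import numFieldNormedType.Exports.

Local Open Scope classical_set_scope.
Local Open Scope ring_scope.

(* On an open set A, for maps between finite-dimensional spaces. *)
Definition C1_on (R : realType) (V W : normedModType R) (A : set V)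
    (f : V -> W) : Prop :=
  (forall w, A w -> differentiable f w) /\
  (forall v w, A w -> {for w, continuous (fun u => 'd f u v)}).

Definition C2_on (R : realType) (V W : normedModType R) (A : set V)
    (f : V -> W) : Prop :=
  C1_on A f /\ (forall v, C1_on A (fun u => 'd f u v)).

(* The Heisenberg group, with coordinates x = p 0 0, y = p 0 1, z = p 0 2.
   The norm of the library on 'rV_3 is the sup norm, with the same topology
   as the Euclidean norm eucl_norm. *)
Definition H1 (R : realType) := 'rV[R]_3.

Definition eucl_norm (R : realType) (v : H1 R) : R :=
  Num.sqrt (\sum_(i < 3) v 0 i ^+ 2).

Definition Theta (R : realType) (p v : H1 R) : R :=
  v 0 2 + p 0 0 * v 0 1 - p 0 1 * v 0 0.

Definition contact_plane (R : realType) (p : H1 R) : set (H1 R) :=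
  [set v | Theta p v = 0].

Definition legendrian_line (R : realType) (L : set (H1 R)) : Prop :=
  exists p v : H1 R,
    [/\ v != 0,
        L = [set p + a *: v | a in [set: R]] &
        forall a : R, Theta (p + a *: v) v = 0].

(* The parameter domain is R * T, where T is the line or the circle, and
   e : R -> T is its universal covering.  The differentiable structure of
   R * T is the one for which cover e : R * R -> R * T is a local
   diffeomorphism: X is C^2, an immersion, etc. when X \o cover e is, and
   the C^1 (C^2) curves of R * T are the cover e \o c, with c a C^1 (C^2)
   curve of R * R. *)
Definition cover (R : realType) (T : Type) (e : R -> T) (w : R * R) : R * T :=
  (w.1, e w.2).

Definition circle (R : realType) : set (R * R) :=
  [set p | p.1 ^+ 2 + p.2 ^+ 2 = 1].
Arguments circle R : clear implicits.

Lemma circle_angleP (R : realType) (a : R) : (cos a, sin a) \in circle R.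
Proof. by rewrite inE /circle /= cos2Dsin2. Qed.

(* set_type carries the subspace topology. *)
Definition S1 (R : realType) := set_type (circle R).

Definition circle_angle (R : realType) (a : R) : S1 R :=
  exist _ (cos a, sin a) (circle_angleP a).

Section ParametrizedSurface.
Context {R : realType} (F : R * R -> H1 R).

Definition immersion : Prop := forall w, injective ('d F w).

Definition tangent_plane (w : R * R) : set (H1 R) := range ('d F w).

Definition singular (w : R * R) : Prop :=
  tangent_plane w = contact_plane (F w).

Definition characteristic_curve (a b : R) (c : R -> R * R) : Prop :=
  [/\ a < b,
      C2_on `]a, b[ c &
      forall tau, tau \in `]a, b[ ->
        [/\ ~ singular (c tau),
            derive1 (F \o c) tau != 0 &
            (tangent_plane (c tau) `&` contact_plane (F (c tau)))
              (derive1 (F \o c) tau)]].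

Definition plane_curvature (x y : R -> R) (tau : R) : R :=
  (derive1 x tau * derive1n 2 y tau - derive1 y tau * derive1n 2 x tau) /
  Num.sqrt (derive1 x tau ^+ 2 + derive1 y tau ^+ 2) ^+ 3.

Definition p_minimal : Prop :=
  forall (a b : R) (c : R -> R * R), characteristic_curve a b c ->
  forall tau, tau \in `]a, b[ ->
    plane_curvature (fun u => F (c u) 0 0) (fun u => F (c u) 0 1) tau = 0.

Definition ruling (L : set (H1 R)) : Prop :=
  legendrian_line L /\
  exists (a b : R) (c : R -> R * R),
    characteristic_curve a b c /\ (F \o c) @` `]a, b[ `<=` L.

Definition pullback_norm (w v : R * R) : R := eucl_norm ('d F w v).

Definition curve_length (c : R -> R * R) : R :=
  \int[lebesgue_measure]_(tau in `[0, 1])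
    pullback_norm (c tau) (derive1 c tau).

End ParametrizedSurface.

Section Surface.
Context {R : realType} {T : topologicalType} (e : R -> T) (X : R * T -> H1 R).

Let F := X \o cover e.

Definition ruling_curve (t : T) : set (H1 R) :=
  [set X (s, t) | s in [set: R]].

(* The curve may a priori be only a piece of the straight line. *)
Definition first_parameter_describes_rulings : Prop :=
  forall t : T, exists2 L, ruling F L & ruling_curve t `<=` L.

Definition ruling_dist (t : T) : R :=
  inf [set eucl_norm p | p in ruling_curve t].

(* The curves need not be regular, so that C^1 and piecewise C^1 curves give
   the same distance: stop at the corners. *)
Definition induced_dist (p q : R * T) : R :=
  inf [set curve_length F c | c in
    [set c : R -> R * R |
      [/\ C1_on setT c, cover e (c 0) = p & cover e (c 1) = q]]].

Definition complete_surface : Prop :=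
  forall u : nat -> R * T,
    (forall eps : R, 0 < eps -> exists N : nat, forall m n : nat,
       (N <= m)%N -> (N <= n)%N -> induced_dist (u m) (u n) < eps) ->
    exists l : R * T, (fun n => induced_dist (u n) l) @ \oo --> (0 : R).

Definition proper_surface : Prop :=
  forall K : set (H1 R), compact K -> compact (X @^-1` K).

Definition ruled_p_minimal_immersion : Prop :=
  [/\ C2_on setT F, immersion F, p_minimal F &
      first_parameter_describes_rulings].

End Surface.

(* Main.v *)
Require Import Defs.
From mathcomp Require Import all_boot all_order all_algebra.
From mathcomp Require Import all_classical all_reals all_analysis.
From mathcomp Require Import ring lra.
Set Implicit Arguments.
Unset Strict Implicit.
Unset Printing Implicit Defensive.

Import Order.TTheory GRing.Theory Num.Theory.
Import numFieldNormedType.Exports.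
Local Open Scope classical_set_scope.
Local Open Scope ring_scope.

(** The rulings of a complete ruled surface are whole straight lines, and this
is the only way in which completeness enters.  Along a ruling, the surface
reads [F (s, t) = p + a s *: v] with [a] increasing ([ruling_paramP]).  If the
ruling stayed bounded as [s] tends to [+oo] or to [-oo], then [a] would have a
finite limit there; the induced distance between two points of a ruling is at
most the length of the segment between their images
([induced_dist_ruling_le]), so that the points of parameters [1, 2, 3, ...]
would form a Cauchy sequence.  But this sequence has no limit: around any
point, an immersion expands vectors by a definite factor
([immersion_expands_locally]), hence a curve that ends there and comes from
outside a fixed neighbourhood has length bounded from below
([induced_dist_ge]).  This is [complete_ruling_unbounded].

Since a norm is a convex function, the part of a ruling in a ball
corresponds to an interval of parameters [s].  If at [t0] this
interval lies strictly between two given parameters, then this remains true for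
[t] near [t0], because it can be read at three points of the ruling
([ruling_sublevel_near]).  By compactness, over a segment of values of [t] the
points of the surface in a compact set have bounded [s], and they form a
compact set ([compact_preimage_strip]).

For the annulus, the segment from [-pi] to [pi] covers the circle, hence
properness.  For the band, properness thus amounts to the preimages of compact
sets being bounded in the direction of [t], which is what the divergence of the
distance from the rulings to the origin says. *)

(** * The Euclidean norm *)

Section EuclideanNorm.
Variable R : realType.
Implicit Types (v : H1 R) (a : R).

Lemma eucl_normZ a v : eucl_norm (a *: v) = `|a| * eucl_norm v.
Proof.
rewrite /eucl_norm -sqrtr_sqr -sqrtrM ?sqr_ge0// mulr_sumr.
by congr Num.sqrt; apply: eq_bigr => i _; rewrite mxE exprMn.
Qed.

Lemma coord_le_eucl_norm v i : `|v 0 i| <= eucl_norm v.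
Proof.
rewrite -sqrtr_sqr ler_wsqrtr// (bigD1 i)//= lerDl.
by apply: sumr_ge0 => j _; exact: sqr_ge0.
Qed.

Lemma norm_le_eucl_norm v : `|v| <= eucl_norm v.
Proof.
rewrite /Num.norm /= mx_normrE; apply/bigmax_leP; split=> [|i _].
  exact: sqrtr_ge0.
by case: i => i j /=; rewrite (ord1 i); exact: coord_le_eucl_norm.
Qed.

Lemma coord_le_norm v i : `|v 0 i| <= `|v|.
Proof.
by rewrite [leRHS]/Num.norm /= mx_normrE; apply: le_trans (le_bigmax _ _ (0, i)).
Qed.

Lemma eucl_norm_le v : eucl_norm v <= 2 * `|v|.
Proof.
rewrite -[leRHS]ger0_norm ?mulr_ge0// -sqrtr_sqr ler_wsqrtr//.
have h i : v 0 i ^+ 2 <= `|v| ^+ 2.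
  by rewrite -[v 0 i ^+ 2]real_normK ?num_real// lerXn2r ?nnegrE// coord_le_norm.
rewrite !big_ord_recl big_ord0 exprMn.
have := h ord0; have := h (lift ord0 ord0); have := h (lift ord0 (lift ord0 ord0)).
have := sqr_ge0 (`|v|); lra.
Qed.

Lemma cvg_sum_ord (T : Type) (G : set_system T) (FG : Filter G) n
    (g : 'I_n -> T -> R) (l : 'I_n -> R) :
  (forall i, g i x @[x --> G] --> l i) ->
  (\sum_(i < n) g i x) @[x --> G] --> \sum_(i < n) l i.
Proof.
elim: n g l => [|n IH] g l gl.
  by rewrite big_ord0; under eq_fun do rewrite big_ord0; exact: cvg_cst.
rewrite big_ord_recl; under eq_fun do rewrite big_ord_recl.
by apply: cvgD; [exact: gl|apply: IH => i; exact: gl].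
Qed.

Lemma continuous_eucl_norm : continuous (@eucl_norm R).
Proof.
move=> v; pose S (u : H1 R) := \sum_(i < 3) u 0 i ^+ 2.
have cS : S u @[u --> v] --> S v.
  apply: (@cvg_sum_ord _ (nbhs v) _ 3 (fun i u => u 0 i ^+ 2)) => i.
  apply: (@cvg_comp _ _ _ (fun u : H1 R => u 0 i) (fun x : R => x ^+ 2)).
    exact: coord_continuous.
  exact: exprn_continuous.
exact: (@cvg_comp _ _ _ S (@Num.sqrt R) (nbhs v) _ _ cS (@sqrt_continuous R _)).
Qed.

End EuclideanNorm.

(** * Lengths of curves *)

Section Speed.
Variables (R : realType) (F : R * R -> H1 R).

Lemma diff_partials w v :
  'd F w v = v.1 *: 'd F w (1, 0) + v.2 *: 'd F w (0, 1).
Proof.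
rewrite -!linearZ -linearD; congr ('d F w _).
by case: v => a b; congr pair; rewrite /= /GRing.scale /=; ring.
Qed.

Lemma continuous_pullback_norm (c : R -> R * R) :
  C1_on setT F -> C1_on setT c ->
  continuous (fun tau => pullback_norm F (c tau) (derive1 c tau)).
Proof.
move=> [_ dFc] [dc dcc] tau.
have cc : c u @[u --> tau] --> c tau.
  by apply: differentiable_continuous; exact: dc.
have c'E u : derive1 c u = 'd c u 1 by rewrite derive1E'//; exact: dc.
have c'c : derive1 c u @[u --> tau] --> derive1 c tau.
  rewrite c'E; under eq_fun do rewrite c'E.
  exact: dcc.
pose p1 u := 'd F (c u) (1, 0); pose p2 u := 'd F (c u) (0, 1).
have cp1 : p1 u @[u --> tau] --> p1 tau.
  exact: (@cvg_comp _ _ _ c (fun w => 'd F w (1, 0)) _ _ _ cc (dFc _ _ I)).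
have cp2 : p2 u @[u --> tau] --> p2 tau.
  exact: (@cvg_comp _ _ _ c (fun w => 'd F w (0, 1)) _ _ _ cc (dFc _ _ I)).
have c1 : (derive1 c u).1 @[u --> tau] --> (derive1 c tau).1.
  exact: (@cvg_comp _ _ _ (derive1 c) fst _ _ _ c'c cvg_fst).
have c2 : (derive1 c u).2 @[u --> tau] --> (derive1 c tau).2.
  exact: (@cvg_comp _ _ _ (derive1 c) snd _ _ _ c'c cvg_snd).
have E : (fun u => 'd F (c u) (derive1 c u)) =
    (fun u => (derive1 c u).1 *: p1 u + (derive1 c u).2 *: p2 u).
  by apply/funext => u; rewrite diff_partials.
have cv : 'd F (c u) (derive1 c u) @[u --> tau] --> 'd F (c tau) (derive1 c tau).
  rewrite E (diff_partials (c tau)).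
  exact: (cvgD (cvgZ c1 cp1) (cvgZ c2 cp2)).
exact: (@cvg_comp _ _ _ (fun u => 'd F (c u) (derive1 c u)) (@eucl_norm R)
  _ _ _ cv (@continuous_eucl_norm R _)).
Qed.

End Speed.

Section Length.
Variable R : realType.

Lemma FTC_C1 (f : R -> R) (a b : R) : a < b ->
  (forall x, derivable f x 1) -> continuous (derive1 f) ->
  \int[lebesgue_measure]_(x in `[a, b]) derive1 f x = f b - f a.
Proof.
move=> ab df cf'.
have cf x : {for x, continuous f}.
  by apply/differentiable_continuous/derivable1_diffP.
have cf'w : {within `[a, b], continuous (derive1 f)}.
  exact: continuous_subspaceT.
have dfab : derivable_oo_LRcontinuous f a b.
  split; [by move=> x _; exact: df|exact: cvg_at_right_filter (cf a)|].
  exact: cvg_at_left_filter (cf b).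
have f'E : {in `]a, b[, derive1 f =1 derive1 f} by [].
by rewrite /Rintegral (continuous_FTC2 ab cf'w dfab f'E).
Qed.

Lemma continuous_integrable_itv (g : R -> R) (a b : R) : continuous g ->
  lebesgue_measure.-integrable `[a, b] (EFin \o g).
Proof.
move=> cg; apply: continuous_compact_integrable; first exact: segment_compact.
exact: continuous_subspaceT.
Qed.

(** Bounds the length of a curve from below: with [g] its speed and [f] a
function that varies along it at most at this speed.  The interval [[a, b]] is
the part of the curve on which this is known; the integral over [[0, 1]] is
the length of the whole curve. *)
Lemma variation_le_integral (f g : R -> R) (a b : R) :
  0 <= a -> a < b -> b <= 1 ->
  (forall x, derivable f x 1) -> continuous (derive1 f) -> continuous g ->
  (forall x, 0 <= g x) -> (forall x, x \in `[a, b] -> `|derive1 f x| <= g x) ->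
  `|f b - f a| <= \int[lebesgue_measure]_(x in `[0, 1]) g x.
Proof.
move=> a0 ab b1 df cf' cg g0 f'g.
have if' := continuous_integrable_itv a b cf'.
have cn : continuous (fun x => `|derive1 f x|).
  by move=> x; apply: cvg_norm; exact: cf'.
rewrite -FTC_C1//; apply: (le_trans (le_normr_Rintegral _ if')) => //.
apply: (@le_trans _ _ (\int[lebesgue_measure]_(x in `[a, b]) g x)).
  by apply: le_Rintegral => //; exact: continuous_integrable_itv.
have ig := continuous_integrable_itv 0 1 cg.
apply: fine_le.
- exact: (integrable_fin_num _ (continuous_integrable_itv a b cg)).
- exact: (integrable_fin_num _ ig).
apply: ge0_subset_integral => //.
- exact: measurable_int ig.
- by move=> x _; rewrite lee_fin.
- by move=> x /=; rewrite !in_itv /= => /andP[h1 h2]; rewrite (le_trans a0)//= (le_trans h2).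
Qed.

End Length.

(** * Local expansion by an immersion *)

Section LocalLowerBound.
Variables (R : realType) (F : R * R -> H1 R).

(** A rank 2 matrix has a nonzero minor: otherwise, with [A] a nonzero column
and [A 0 i] a nonzero entry of it, the vector [(- B 0 i, A 0 i)] is in the
kernel. *)
Lemma injective_minor w : injective ('d F w) ->
  exists i j, 'd F w (1, 0) 0 i * 'd F w (0, 1) 0 j
            - 'd F w (1, 0) 0 j * 'd F w (0, 1) 0 i != 0.
Proof.
move=> inj; set A := 'd F w (1, 0); set B := 'd F w (0, 1).
have dF0 v : v.1 *: A + v.2 *: B = 0 -> v = 0.
  by rewrite -diff_partials => dv; apply: inj; rewrite dv linear0.
have [i Ai0] : exists i, A 0 i != 0.
  apply: contrapT => A0.
  have /dF0[/eqP] : (1 : R, 0 : R).1 *: A + (1 : R, 0 : R).2 *: B = 0.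
    rewrite scale0r addr0 scale1r; apply/rowP => i; rewrite [RHS]mxE.
    by apply: contrapT => /eqP Ai; apply: A0; exists i.
  by rewrite oner_eq0.
exists i; apply: contrapT => minors.
have /dF0[_ /eqP] : (- B 0 i, A 0 i).1 *: A + (- B 0 i, A 0 i).2 *: B = 0.
  apply/rowP => j; rewrite !mxE /=; apply: contrapT => /eqP ABj.
  by apply: minors; exists j; apply: contra ABj => /eqP <-; apply/eqP; ring.
by rewrite (negbTE Ai0).
Qed.

(** By Cramer's rule, a vector is recovered from its image by multiplication
by bounded coefficients and division by a minor of the differential; the minor
that is nonzero at [l] stays away from zero near [l], and the coefficients of
the differential stay bounded. *)
Lemma immersion_expands_locally l : C1_on setT F -> injective ('d F l) ->
  exists k r, [/\ 0 < k, 0 < r & forall w, `|w - l| <= r ->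
    forall v, k * `|v| <= pullback_norm F w v].
Proof.
move=> [_ dFc] /injective_minor[i [j]].
pose A w := 'd F w (1, 0); pose B w := 'd F w (0, 1).
pose D w := A w 0 i * B w 0 j - A w 0 j * B w 0 i.
rewrite -/(A l) -/(B l) -/(D l) => Dl0.
have cA : A w @[w --> l] --> A l by exact: dFc.
have cB : B w @[w --> l] --> B l by exact: dFc.
have cAi m : A w 0 m @[w --> l] --> A l 0 m.
  exact: (@cvg_comp _ _ _ A (fun u : H1 R => u 0 m) _ _ _
    cA (@coord_continuous _ _ _ _ _ _)).
have cBi m : B w 0 m @[w --> l] --> B l 0 m.
  exact: (@cvg_comp _ _ _ B (fun u : H1 R => u 0 m) _ _ _
    cB (@coord_continuous _ _ _ _ _ _)).
have cD : D w @[w --> l] --> D l.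
  exact: (cvgB (cvgM (cAi i) (cBi j)) (cvgM (cAi j) (cBi i))).
pose b := `|A l| + `|B l| + 1; pose d := `|D l| / 2.
have d0 : 0 < d by rewrite divr_gt0// normr_gt0.
have b0 : 0 < b by rewrite ltr_wpDl// addr_ge0.
have dD : d < `|D l|.
  by rewrite ltr_pdivrMr// ltr_pMr ?normr_gt0//; lra.
have Al0 := normr_ge0 (A l); have Bl0 := normr_ge0 (B l).
have Ab : `|A l| < b by rewrite /b; lra.
have Bb : `|B l| < b by rewrite /b; lra.
have nD : \forall w \near l, d < `|D w| by exact: (cvgr_norm_gt _ cD).
have nA : \forall w \near l, `|A w| < b by exact: (cvgr_norm_lt _ cA).
have nB : \forall w \near l, `|B w| < b by exact: (cvgr_norm_lt _ cB).
have : \forall w \near l, d < `|D w| /\ (`|A w| < b /\ `|B w| < b).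
  exact: filterI nD (filterI nA nB).
rewrite nbhs_normP => -[e /= e0 he].
have b20 : 0 < 2 * b by exact: mulr_gt0.
exists (d / (2 * b)), (e / 2); split; [exact: divr_gt0|exact: divr_gt0|move=> w wl v].
have [{}nD [{}nA {}nB]] : d < `|D w| /\ (`|A w| < b /\ `|B w| < b).
  apply: he; rewrite /ball_ /= distrC (le_lt_trans wl)// ltr_pdivrMr//.
  by rewrite ltr_pMr//; lra.
rewrite mulrAC ler_pdivrMr//.
rewrite /pullback_norm; set P := 'd F w v.
have Pm m : P 0 m = v.1 * A w 0 m + v.2 * B w 0 m.
  by rewrite /P diff_partials !mxE.
have minor (x y p q : R) : `|x| <= b -> `|y| <= b -> `|p| <= eucl_norm P ->
    `|q| <= eucl_norm P -> `|p * x - q * y| <= eucl_norm P * (2 * b).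
  move=> xb yb pP qP; apply: (le_trans (ler_normB _ _)); rewrite !normrM.
  rewrite [leRHS](_ : _ = eucl_norm P * b + eucl_norm P * b); last by ring.
  by apply: lerD; apply: ler_pM.
have bd c : `|c * D w| <= eucl_norm P * (2 * b) -> d * `|c| <= eucl_norm P * (2 * b).
  apply: le_trans; rewrite normrM [d * _]mulrC.
  by apply: ler_wpM2l; [exact: normr_ge0|exact: ltW].
have Ac m : `|A w 0 m| <= b by exact: (le_trans (coord_le_norm _ _)) (ltW nA).
have Bc m : `|B w 0 m| <= b by exact: (le_trans (coord_le_norm _ _)) (ltW nB).
(* Cramer's rule for the larger of the two coordinates of v *)
rewrite prod_normE; case: (leP `|v.1| `|v.2|) => _; apply: bd.
  rewrite (_ : v.2 * D w = P 0 j * A w 0 i - P 0 i * A w 0 j); last by rewrite !Pm /D; ring.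
  by apply: minor => //; exact: coord_le_eucl_norm.
rewrite (_ : v.1 * D w = P 0 i * B w 0 j - P 0 j * B w 0 i); last by rewrite !Pm /D; ring.
by apply: minor => //; exact: coord_le_eucl_norm.
Qed.

End LocalLowerBound.

(** * Curves in the plane *)

Section Curves.
Variable R : realType.

Lemma continuous_pairr (s : R) : continuous (fun t : R => (s, t) : R * R).
Proof.
move=> t; have cs : s @[_ --> t] --> s by exact: cvg_cst.
exact: (cvg_pair cs (@cvg_id _ (nbhs t))).
Qed.

Lemma continuous_pairl (t : R) : continuous (fun s : R => (s, t) : R * R).
Proof.
move=> s; have ct : t @[_ --> s] --> t by exact: cvg_cst.
exact: (cvg_pair (@cvg_id _ (nbhs s)) ct).
Qed.

Lemma diff_line (V : normedModType R) (w d : V) u :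
  differentiable (fun tau : R => w + tau *: d) u /\
  'd (fun tau : R => w + tau *: d) u = *:%R^~ d :> (R -> V).
Proof.
have E : (fun tau : R => w + tau *: d) = cst w + *:%R^~ d by [].
have ds : differentiable ( *:%R^~ d : R -> V) u by exact: ex_diff.
split; first by rewrite E; apply: differentiableD.
by rewrite E diffD// diff_cst diff_val; apply/funext => x /=; rewrite add0r.
Qed.

Lemma C1_line (V : normedModType R) (w d : V) :
  C1_on setT (fun tau : R => w + tau *: d).
Proof.
split=> [tau _|v tau _]; first exact: (diff_line w d tau).1.
rewrite (_ : (fun u => _) = cst (v *: d)); first exact: cvg_cst.
by apply/funext => u; rewrite (diff_line w d u).2.
Qed.

Lemma derive1_line (V : normedModType R) (w d : V) u :
  derive1 (fun tau : R => w + tau *: d) u = d.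
Proof. by have [dl dE] := diff_line w d u; rewrite derive1E'// dE scale1r. Qed.

Lemma derive1_comp_linear (V W : normedModType R) (p : {linear V -> W})
    (c : R -> V) tau : continuous p -> differentiable c tau ->
  derivable (p \o c) tau 1 /\ derive1 (p \o c) tau = p (derive1 c tau).
Proof.
move=> cp dc.
have dp : differentiable p (c tau) by exact: linear_differentiable.
have dpc : differentiable (p \o c) tau by exact: differentiable_comp.
split; first by apply/derivable1_diffP.
by rewrite (derive1E' dpc) (derive1E' dc) diff_comp// diff_lin.
Qed.

Lemma derive1_affine (a : R -> R) (k x d tau : R) : (forall s, derivable a s 1) ->
  derivable (fun u : R => k * a (x + u * d)) tau 1 /\
  derive1 (fun u : R => k * a (x + u * d)) tau = k * (d * derive1 a (x + tau * d)).
Proof.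
move=> da; pose L (u : R) := x + u * d.
have dL : derivable L tau 1 by apply/derivable1_diffP; exact: (diff_line x d tau).1.
have L' : derive1 L tau = d by exact: derive1_line.
have aL : derivable (a \o L) tau 1.
  have daL := (derivable1_diffP a (L tau)).1 (da (L tau)).
  have dL' : differentiable L tau by apply/derivable1_diffP.
  by apply/derivable1_diffP; exact: (differentiable_comp dL' daL).
split; first exact: (@derivableZ _ _ _ (a \o L) k _ _ aL).
rewrite derive1E (@deriveZ _ _ _ (a \o L) k _ _ aL) -derive1E.
by rewrite (derive1_comp dL (da (L tau))) L'; congr (k * _); exact: mulrC.
Qed.

Lemma diff_translate (G : R * R -> H1 R) (h w : R * R) v :
  (forall w, differentiable G w) -> (forall w, G (w + h) = G w) ->
  'd G (w + h) v = 'd G w v.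
Proof.
move=> dG Gh.
apply: etrans (esym (deriveE v (dG (w + h)))) _.
apply: etrans _ (deriveE v (dG w)).
have quotE : (fun x : R => x^-1 *: ((G \o shift (w + h)) (x *: v) - G (w + h))) =
    (fun x : R => x^-1 *: ((G \o shift w) (x *: v) - G w)).
  by apply/funext => x; rewrite /= addrA !Gh.
by rewrite /derive quotE.
Qed.

Lemma continuous_derive1_C1 (c : R -> R * R) : C1_on setT c -> continuous (derive1 c).
Proof.
move=> [dc dcc] tau.
rewrite (_ : derive1 c = fun u => 'd c u 1); first exact: dcc.
by apply/funext => u; rewrite derive1E'//; exact: dc.
Qed.

(** The last point of the curve at distance [r] from its end: after it, the
curve stays in the ball, by the intermediate value theorem. *)
Lemma last_time_at_distance (V : normedModType R) (c : R -> V) (l : V) (r : R) :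
  continuous c -> c 1 = l -> 0 < r -> r <= `|c 0 - l| ->
  exists tau, [/\ 0 <= tau, tau < 1, `|c tau - l| = r &
    forall sigma, tau <= sigma <= 1 -> `|c sigma - l| <= r].
Proof.
move=> cc c1 r0 rc.
pose h tau := `|c tau - l|.
have ch : continuous h.
  by move=> x; apply: cvg_norm; apply: cvgB; [exact: cc|exact: cvg_cst].
have h1 : h 1 = 0 by rewrite /h c1 subrr normr0.
have hit a : 0 <= a <= 1 -> r <= h a -> exists2 b, a <= b <= 1 & h b = r.
  move=> /andP[a0 a1] ra.
  have [|||b bI hb] := @IVT _ h a 1 r => //.
  - exact: continuous_subspaceT.
  - rewrite h1 (le_trans _ (ltW r0)) ?ge_min ?lexx ?orbT//=.
    by rewrite le_max ra.
  by exists b => //; rewrite in_itv/= in bI.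
pose S := `[0, 1]%classic `&` [set tau | h tau = r].
have [|b0 /andP[b00 b01] hb0] := hit 0 _ rc; first by rewrite lexx ler01.
have S0 : S !=set0 by exists b0; split=> //; rewrite /= in_itv/= b00.
have cS : compact S.
  apply: (subclosed_compact _ (@segment_compact _ 0 1)); last by move=> x [].
  apply: closedI; first exact: itv_closed.
  rewrite (_ : [set _ | _] = h @^-1` [set r])//.
  by apply: closed_comp; [move=> x _; exact: ch|exact: closed_eq].
have [tau /set_mem[tauI htau] tau_max] :
    exists2 tau, tau \in S & forall t, t \in S -> t <= tau.
  apply: (@compact_EVT_max _ _ (fun x : R => x)) => //.
  by apply: continuous_subspaceT => x; exact: cvg_id.
move: tauI; rewrite /= in_itv/= => /andP[tau0 tau1].
exists tau; split=> //.
- rewrite lt_neqAle tau1 andbT; apply: contraTN r0 => /eqP tauE.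
  by rewrite -htau tauE h1 ltxx.
- move=> s /andP[taus s1]; rewrite -/(h s) leNgt; apply/negP => rs.
  have [|b /andP[sb b1] hb] := hit s _ (ltW rs).
    by rewrite (le_trans tau0)//.
  have bS : S b.
    by split=> //; rewrite /= in_itv/= b1 (le_trans tau0)// (le_trans taus).
  have /eqP sE : s == tau by rewrite eq_le taus andbT (le_trans sb)// tau_max ?inE.
  by move: rs; rewrite sE htau ltxx.
Qed.

(** From the last time at distance [r] on, the curve is in the ball where [F]
expands, and one of its two coordinates varies by [r], since the norm on
[R * R] is the maximum norm. *)
Lemma curve_length_ge (F : R * R -> H1 R) (c : R -> R * R) (l : R * R) (k r : R) :
  C1_on setT F -> C1_on setT c -> c 1 = l -> 0 < k -> 0 < r ->
  (forall w, `|w - l| <= r -> forall v, k * `|v| <= pullback_norm F w v) ->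
  r <= `|c 0 - l| -> k * r <= curve_length F c.
Proof.
move=> C1F C1c c1 k0 r0 kF rc.
have dc u : differentiable c u by exact: C1c.1.
have cc : continuous c by move=> u; exact: differentiable_continuous.
have [tau [tau0 tau1 htau near_l]] := last_time_at_distance cc c1 r0 rc.
have c'c := continuous_derive1_C1 C1c.
have main (p : R * R -> R) :
    (forall u, derivable (p \o c) u 1 /\ derive1 (p \o c) u = p (derive1 c u)) ->
    continuous p -> (forall v, `|p v| <= `|v|) ->
    r <= `|p (c 1) - p (c tau)| -> k * r <= curve_length F c.
  move=> dp cp p1 rp.
  rewrite -ler_pdivlMl//; apply: (le_trans rp).
  rewrite ler_pdivlMl//.
  rewrite -[k in k * _](gtr0_norm k0) -normrM mulrBr.
  have dkp u : derivable (fun x => k * p (c x)) u 1 /\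
      derive1 (fun x => k * p (c x)) u = k * p (derive1 c u).
    have [h1 h2] := dp u; split; first exact: (@derivableZ _ _ _ (p \o c) k _ _ h1).
    by rewrite derive1E (@deriveZ _ _ _ (p \o c) k _ _ h1) -derive1E h2.
  apply: (variation_le_integral (f := fun x => k * p (c x)) tau0 tau1 (lexx _)).
  - by move=> u; exact: (dkp u).1.
  - rewrite (_ : derive1 _ = fun u => k * p (derive1 c u)); last first.
      by apply/funext => u; rewrite (dkp u).2.
    move=> u; apply: cvgM; first exact: cvg_cst.
    exact: (@cvg_comp _ _ _ (derive1 c) p _ _ _ (c'c u) (cp _)).
  - exact: continuous_pullback_norm.
  - by move=> x; exact: sqrtr_ge0.
  - move=> x; rewrite in_itv/= => xI; rewrite (dkp x).2 normrM gtr0_norm//.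
    apply: (le_trans _ (kF _ (near_l _ xI) _)).
    by rewrite ler_pM2l.
have : r <= `|(c tau - l).1| \/ r <= `|(c tau - l).2|.
  by apply/orP; rewrite -le_max -htau prod_normE.
case=> rl.
- apply: (main fst) => [u||v|].
  + by apply: derive1_comp_linear => // x; exact: cvg_fst.
  + by move=> x; exact: cvg_fst.
  + by rewrite prod_normE le_max lexx.
  + by rewrite distrC c1.
- apply: (main snd) => [u||v|].
  + by apply: derive1_comp_linear => // x; exact: cvg_snd.
  + by move=> x; exact: cvg_snd.
  + by rewrite prod_normE le_max lexx orbT.
  + by rewrite distrC c1.
Qed.

End Curves.

(** * Rulings *)

Section Rulings.
Variable R : realType.

Lemma derive1_along_line (F : R * R -> H1 R) (w d : R * R) (tau : R) :
  (forall w, differentiable F w) ->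
  derivable (fun tau : R => F (w + tau *: d)) tau 1 /\
  derive1 (fun tau : R => F (w + tau *: d)) tau = 'd F (w + tau *: d) d.
Proof.
move=> dF; have [dl dlE] := diff_line w d tau.
have dFl : differentiable (F \o (fun tau : R => w + tau *: d)) tau.
  by apply: differentiable_comp => //; exact: dF.
split; first by apply/derivable1_diffP.
by rewrite derive1E'// diff_comp//= dlE scale1r.
Qed.

Lemma nonvanishing_sign (f : R -> R) : continuous f -> (forall x, f x != 0) ->
  (forall x, 0 < f x) \/ (forall x, f x < 0).
Proof.
move=> cf f0.
have same x y : x <= y -> (0 < f x) = (0 < f y).
  move=> xy; apply: contrapT => /eqP neq.
  have [|||z _ fz] := @IVT _ f x y 0 => //.
  - exact: continuous_subspaceT.
  - move: neq (f0 x) (f0 y); rewrite ge_min le_max.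
    by case: (ltgtP 0 (f x)) => //; case: (ltgtP 0 (f y)).
  - by move: (f0 z); rewrite fz eqxx.
have sign x : (0 < f x) = (0 < f 0).
  by have [/same//|/ltW/same] := leP x 0.
have [f00|f00] := boolP (0 < f 0).
  by left=> x; rewrite sign.
by right=> x; rewrite lt_neqAle f0 leNgt sign.
Qed.

(** The sign of [derive1 a] is a normalization: the direction [v] of the line
is reversed if need be, so that [a] is increasing. *)
Definition ruling_param (F : R * R -> H1 R) (t : R) (p v : H1 R) (a : R -> R) :=
  [/\ forall s, F (s, t) = p + a s *: v,
      forall s, derivable a s 1,
      continuous (derive1 a),
      forall s, 0 < derive1 a s &
      forall s, 'd F (s, t) (1, 0) = derive1 a s *: v].

(** The coordinate [a] along the line inherits its regularity from a
coordinate of the ambient space in which [v] does not vanish; its derivative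
never vanishes because [F] is an immersion, hence keeps its sign. *)
Lemma ruling_paramP (F : R * R -> H1 R) t L :
  C1_on setT F -> immersion F -> legendrian_line L -> (forall s, L (F (s, t))) ->
  exists p v a, v != 0 /\ ruling_param F t p v a.
Proof.
move=> [dF dFc] immF [p [v [v0 -> _]]] FL.
have /boolp.choice[a aE] : forall s, exists b, p + b *: v = F (s, t).
  by move=> s; have [b _ <-] := FL s; exists b.
have [i vi] : exists i, v 0 i != 0.
  apply: contrapT => vi; move: v0; rewrite (_ : v = 0) ?eqxx//.
  apply/rowP => i; rewrite mxE; apply: contrapT => /eqP vi0; apply: vi.
  by exists i.
have slice s : (0, t) + s *: (1, 0) = (s, t).
  by congr pair; rewrite /= /GRing.scale /=; ring.
have dFs s : derivable (fun s => F (s, t)) s 1 /\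
    derive1 (fun s => F (s, t)) s = 'd F (s, t) (1, 0).
  have := derive1_along_line (0, t) (1, 0) s (fun w => dF w I).
  by under eq_fun do rewrite slice; rewrite slice.
pose g s := F (s, t) 0 i.
have dg s : derivable g s 1 /\ derive1 g s = 'd F (s, t) (1, 0) 0 i.
  have [h1 h2] := dFs s; split; first by move/derivable_mxP : h1; apply.
  by rewrite -h2 !derive1E derive_mx// mxE.
have aE' s : a s = (v 0 i)^-1 * (g s - p 0 i).
  by rewrite /g -aE !mxE; field.
have da s : derivable a s 1.
  rewrite (_ : a = (v 0 i)^-1 \*: (g - cst (p 0 i))); last exact: funext.
  by apply: derivableZ; apply: derivableB => //; exact: (dg s).1.
have dFa s : 'd F (s, t) (1, 0) = derive1 a s *: v.
  rewrite -(dFs s).2 (_ : (fun _ => _) = cst p + (fun s => a s *: v)); last first.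
    by apply/funext => u; rewrite -aE.
  have dav : differentiable (fun s : R => a s *: v) s.
    by apply: differentiableZl; apply/derivable1_diffP.
  have dav1 : derivable (fun s : R => a s *: v) s 1 by apply/derivable1_diffP.
  rewrite derive1E (deriveD _ dav1); last exact: derivable_cst.
  rewrite derive_cst add0r deriveE// diffZl; last by apply/derivable1_diffP.
  by rewrite derive1E'//; apply/derivable1_diffP.
have a'E : derive1 a = fun s => (v 0 i)^-1 * 'd F (s, t) (1, 0) 0 i.
  by apply/funext => s; rewrite dFa mxE; field.
have ca' : continuous (derive1 a).
  rewrite a'E => s; apply: cvgM; first exact: cvg_cst.
  have cp : 'd F (u, t) (1, 0) @[u --> s] --> 'd F (s, t) (1, 0).
    have cst_ : {for s, continuous (fun u : R => (u, t) : R * R)}.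
      exact: continuous_pairl.
    exact: (@cvg_comp _ _ _ (fun u => (u, t)) (fun w => 'd F w (1, 0)) _ _ _
      cst_ (dFc _ _ I)).
  exact: (@cvg_comp _ _ _ (fun u => 'd F (u, t) (1, 0))
    (fun M : H1 R => M 0 i) _ _ _ cp (@coord_continuous _ _ _ _ _ _)).
have a'0 s : derive1 a s != 0.
  apply/eqP => a0; have /(immF (s, t)) : 'd F (s, t) (1, 0) = 'd F (s, t) 0.
    by rewrite dFa a0 scale0r linear0.
  by move=> [] /eqP; rewrite oner_eq0.
case: (nonvanishing_sign ca' a'0) => sa.
  by exists p, v, a; split=> //; split=> // s; rewrite aE.
have dNa s : derive1 (- a) s = - derive1 a s by rewrite !derive1E deriveN.
exists p, (- v), (- a); split; [by rewrite oppr_eq0|split].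
- by move=> s; rewrite -aE scalerN scaleNr opprK.
- by move=> s; exact: derivableN.
- by rewrite (funext dNa) => s; apply: cvgN; exact: ca'.
- by move=> s; rewrite dNa oppr_gt0.
- by move=> s; rewrite dFa dNa scalerN scaleNr opprK.
Qed.

Lemma ruling_param_mono F t p v a : ruling_param F t p v a ->
  {homo a : x y / x <= y}.
Proof.
move=> [_ da _ a'0 _] x y; rewrite le_eqVlt => /predU1P[->//|xy].
have [||c _ ac] := @MVT _ a (derive1 a) x y xy.
- by move=> z _; rewrite derive1E; apply: derivableP.
- by apply: continuous_subspaceT => z; apply/differentiable_continuous/derivable1_diffP.
by rewrite -subr_ge0 ac mulr_ge0 ?subr_ge0 ?(ltW xy)// ltW.
Qed.

(** Convexity of the norm on the line that carries the ruling. *)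
Lemma ruling_param_between F t p v a s1 s2 s3 M : ruling_param F t p v a ->
  s1 <= s2 <= s3 -> `|F (s1, t)| <= M -> `|F (s3, t)| <= M -> `|F (s2, t)| <= M.
Proof.
move=> ra /andP[s12 s23] F1 F3; have mono := ruling_param_mono ra.
have [FE _ _ _ _] := ra.
have := mono _ _ s12; have := mono _ _ s23; move: F1 F3; rewrite !FE.
set a1 := a s1; set a2 := a s2; set a3 := a s3 => F1 F3 a23 a12.
have [a13|a13] := eqVneq a1 a3.
  by have -> : a2 = a1 by apply/eqP; rewrite eq_le a12 a13 a23.
have d0 : 0 < a3 - a1 by rewrite subr_gt0 lt_neqAle a13 (le_trans a12).
have comb : (a3 - a1) *: (p + a2 *: v) =
    (a3 - a2) *: (p + a1 *: v) + (a2 - a1) *: (p + a3 *: v).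
  by apply/rowP => i; rewrite !mxE; ring.
rewrite -(ler_pM2l d0) -[X in X * `|_|](gtr0_norm d0) -normrZ comb.
rewrite (le_trans (ler_normD _ _))// !normrZ !ger0_norm ?subr_ge0//.
rewrite (_ : (a3 - a1) * M = (a3 - a2) * M + (a2 - a1) * M); last by ring.
by apply: lerD; apply: ler_wpM2l; rewrite ?subr_ge0.
Qed.

End Rulings.

(** * The induced distance and completeness *)

Section InducedDistance.
Variables (R : realType) (T : topologicalType) (e : R -> T) (X : R * T -> H1 R).

Let F := X \o Defs.cover e.

Hypothesis e_surj : forall theta, exists t, e t = theta.
(** Translations of the line by a difference of two points of a fibre are deck
transformations. *)
Hypothesis e_deck : forall t1 t2 t, e t1 = e t2 -> e (t + (t1 - t2)) = e t.
Hypothesis C1F : C1_on setT F.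

Lemma curve_length_ge0 c : 0 <= curve_length F c.
Proof. by apply: Rintegral_ge0 => x _; exact: sqrtr_ge0. Qed.

(** The ruling itself is the curve: its speed has a constant sign along the
line, so that its length is the distance between its ends. *)
Lemma induced_dist_ruling_le t p v a x y : ruling_param F t p v a ->
  induced_dist e X (x, e t) (y, e t) <= `|a y - a x| * eucl_norm v.
Proof.
move=> ra; have mono := ruling_param_mono ra; case: ra => [_ da ca' a'0 dFa].
pose c (tau : R) : R * R := (x, t) + tau *: (y - x, 0).
have cE tau : c tau = (x + tau * (y - x), t).
  by rewrite /c; congr pair; rewrite /= /GRing.scale /=; ring.
have lc : curve_length F c = `|a y - a x| * eucl_norm v.
  (* the speed is |y - x| a' |v|, while the derivative of a along the curve
     is (y - x) a' *)
  pose k := (if x <= y then 1 else - 1) * eucl_norm v.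
  pose f tau := k * a (x + tau * (y - x)).
  have df tau : derivable f tau 1 /\
      derive1 f tau = k * ((y - x) * derive1 a (x + tau * (y - x))).
    exact: derive1_affine.
  have f'E : derive1 f = fun tau => pullback_norm F (c tau) (derive1 c tau).
    apply/funext => tau; rewrite (df tau).2 derive1_line /pullback_norm diff_partials cE/=.
    rewrite scale0r addr0 dFa scalerA eucl_normZ normrM (gtr0_norm (a'0 _)) /k.
    by case: leP => xy; [rewrite ger0_norm ?subr_ge0//|rewrite ltr0_norm ?subr_lt0//]; ring.
  have -> : curve_length F c = f 1 - f 0.
    transitivity (\int[lebesgue_measure]_(x in `[0, 1]) derive1 f x).
      by rewrite f'E.
    have df1 tau : derivable f tau 1 by exact: (df tau).1.
    have cf' : continuous (derive1 f).
      by rewrite f'E; apply: continuous_pullback_norm; [exact: C1F|exact: C1_line].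
    exact: (FTC_C1 ltr01 df1 cf').
  rewrite /f /k mul0r addr0 mul1r [x + (y - x)]addrC subrK.
  case: leP => xy; last by rewrite ler0_norm ?subr_le0 ?mono ?ltW//; ring.
  by rewrite ger0_norm ?subr_ge0 ?mono//; ring.
rewrite -lc; apply: ge_inf; last first.
  by exists c => //; split; [exact: C1_line|..]; rewrite cE /Defs.cover /=; congr pair; ring.
by exists 0 => _ [d _ <-]; exact: curve_length_ge0.
Qed.

(** The curves that compete in the distance to [cover e l] end at any point of
the fibre, where the expansion factor is the same as at [l], because a deck
transformation preserves [F]. *)
Lemma induced_dist_ge (l : R * R) : injective ('d F l) ->
  exists k, 0 < k /\ exists r, 0 < r /\ forall q : R * T, r <= `|q.1 - l.1| ->
    k <= induced_dist e X q (Defs.cover e l).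
Proof.
move=> injl; have [k [r [k0 r0 kF]]] := immersion_expands_locally C1F injl.
exists (k * r); split; first exact: mulr_gt0.
exists r; split=> // -[q1 q2] /= rq.
apply: lb_le_inf.
  have [t <-] := e_surj q2.
  exists (curve_length F (fun tau : R => (q1, t) + tau *: (l - (q1, t)))).
  exists (fun tau : R => (q1, t) + tau *: (l - (q1, t))) => //.
  split; first exact: C1_line; first by rewrite scale0r addr0.
  by rewrite scale1r addrC subrK.
move=> _ [c [C1c c0 c1] <-].
have el : e l.2 = e (c 1).2 by move: c1 => [].
pose h : R * R := (0, l.2 - (c 1).2).
have Fh w : F (w + h) = F w.
  by rewrite /F /= /Defs.cover /= addr0 e_deck.
have lh : l = c 1 + h.
  move: c1 => [c11 _]; rewrite /h [l]surjective_pairing -c11.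
  by rewrite [c 1 in RHS]surjective_pairing; congr pair => /=; ring.
apply: (curve_length_ge C1F C1c erefl k0 r0) => [w wr v|].
  rewrite /pullback_norm -(diff_translate (h := h))//; last by move=> u; exact: C1F.1.
  by apply: kF; rewrite lh opprD addrACA subrr addr0.
apply: (le_trans rq); move: c0 c1 => [<- _] [<- _].
by rewrite prod_normE le_max lexx.
Qed.

(** [sg] is 1 or -1 and tells the end of the ruling.  A bounded half ruling
would give a Cauchy sequence whose first parameter is unbounded. *)
Lemma complete_ruling_unbounded t p v a (sg M : R) :
  immersion F -> complete_surface e X -> v != 0 -> ruling_param F t p v a ->
  `|sg| = 1 -> exists2 s, 0 < s & M < `|F (sg * s, t)|.
Proof.
move=> immF cX v0 ra sg1; apply: contrapT => bnd.
have FM s : 0 < s -> `|F (sg * s, t)| <= M.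
  by move=> s0; rewrite leNgt; apply/negP => Ms; apply: bnd; exists s.
have a_mono := ruling_param_mono ra.
have [FE _ _ _ _] := ra.
have nv0 : 0 < `|v| by rewrite normr_gt0.
have nev0 : 0 < eucl_norm v by exact: lt_le_trans (norm_le_eucl_norm v).
(* the factor sg makes b nondecreasing at either end *)
pose b n := sg * a (sg * n.+1%:R).
have sg2 : sg * sg = 1 by rewrite -expr2 -real_normK ?num_real// sg1 expr1n.
have b_mono : {homo b : n m / (n <= m)%N >-> n <= m}.
  move=> n m nm; have nmR : n.+1%:R <= m.+1%:R :> R by rewrite ler_nat.
  rewrite /b; have [s0|s0] := leP 0 sg.
    by apply: ler_wpM2l => //; apply: a_mono; exact: ler_wpM2l.
  by apply: ler_wnM2l; [exact: ltW|]; apply: a_mono; apply: ler_wnM2l; first exact: ltW.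
have b_bnd : has_ubound (range b).
  exists ((M + `|p|) / `|v|) => _ [n _ <-].
  rewrite ler_pdivlMr//; apply: (le_trans (ler_norm _)).
  rewrite normrM normr_id -normrZ.
  have -> : b n *: v = sg *: (F (sg * n.+1%:R, t) - p).
    by rewrite FE addrC addKr scalerA.
  rewrite normrZ sg1 mul1r (le_trans (ler_normB _ _))// lerD2r.
  exact: FM.
have cb := nondecreasing_is_cvgn b_mono b_bnd.
pose u n : R * T := (sg * n.+1%:R, e t).
have [|[l1 theta] ul] := cX u.
  move=> eps eps0.
  have /cvgrPdist_lt/(_ (eps / eucl_norm v / 2)) : b @ \oo --> limn b by [].
  case=> [|N _ bN]; first by rewrite !divr_gt0.
  exists N => m n Nm Nn.
  apply: (le_lt_trans (induced_dist_ruling_le _ _ ra)).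
  rewrite -ltr_pdivlMr//.
  have -> : `|a (sg * n.+1%:R) - a (sg * m.+1%:R)| = `|b n - b m|.
    by rewrite /b -mulrBr normrM sg1 mul1r.
  rewrite (le_lt_trans (ler_distD (limn b) _ _))// [ltRHS]splitr.
  by apply: ltrD; [rewrite distrC|]; exact: bN.
have [t0 et0] := e_surj theta.
have [k [k0 [r [r0 kr]]]] := induced_dist_ge (immF (l1, t0)).
have : \forall n \near \oo, induced_dist e X (u n) (l1, theta) < k.
  exact: (cvgr_lt _ ul).
case=> N _ uN.
pose n := maxn N (Num.trunc (r + `|l1|)).
have := uN n (leq_maxl _ _); apply/negP; rewrite -leNgt -et0; apply: kr => /=.
rewrite (le_trans _ (lerB_dist _ _))// normrM sg1 mul1r lerBrDr.
rewrite ger0_norm// (le_trans (ltW (truncnS_gt _)))// ler_nat ltnS.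
exact: leq_maxr.
Qed.

End InducedDistance.

(** * Compactness over a segment of rulings *)

Section CompactPreimages.
Variables (R : realType) (F : R * R -> H1 R).

Hypothesis cF : continuous F.
Hypothesis F_between : forall t s1 s2 s3 M, s1 <= s2 <= s3 ->
  `|F (s1, t)| <= M -> `|F (s3, t)| <= M -> `|F (s2, t)| <= M.
Hypothesis F_unbounded : forall t sg M, `|sg| = 1 ->
  exists2 s, 0 < s & M < `|F (sg * s, t)|.

(** It suffices that the ruling be inside a larger ball at [s = 0] and outside
of it at one point on each side: these are open conditions on [t], and
[F_between] then keeps the ruling outside of the ball further away. *)
Lemma ruling_sublevel_near (t0 M : R) :
  \forall t \near t0 & S \near +oo, forall s, `|F (s, t)| <= M -> `|s| <= S.
Proof.
pose M' := Num.max M (`|F (0, t0)| + 1).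
have [s1 s10 Fs1] := F_unbounded t0 M' (normr1 R).
have [s2 s20 Fs2] := F_unbounded t0 M' (normrN1 R).
have cFs s : `|F (s, t)| @[t --> t0] --> `|F (s, t0)|.
  have cFs : F (s, t) @[t --> t0] --> F (s, t0).
    exact: (@cvg_comp _ _ _ (fun t : R => (s, t)) F _ _ _
      (@continuous_pairr R s t0) (@cF _)).
  exact: cvg_norm cFs.
have n0 : \forall t \near t0, `|F (0, t)| < M'.
  by apply: (cvgr_lt _ (cFs 0)); rewrite lt_max orbC ltrDl ltr01.
have n1 : \forall t \near t0, M' < `|F (1 * s1, t)| by exact: (cvgr_gt _ (cFs _)).
have n2 : \forall t \near t0, M' < `|F (- 1 * s2, t)| by exact: (cvgr_gt _ (cFs _)).
exists ([set t | [/\ `|F (0, t)| < M', M' < `|F (1 * s1, t)| & M' < `|F (- 1 * s2, t)|]],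
  [set S | Num.max s1 s2 <= S]).
  split; last by exact: nbhs_pinfty_ge (num_real _).
  by apply: filterS3 n0 n1 n2 => t *; split.
case=> t S [/= [m0 m1 m2]]; rewrite ge_max => /andP[sS1 sS2] s FM.
have FM' : `|F (s, t)| <= M' by rewrite le_max FM.
have M'0 : `|F (0, t)| <= M' by exact: ltW.
rewrite ler_norml; apply/andP; split; rewrite leNgt; apply/negP => h.
- move: m2; rewrite ltNge => /negP; apply; apply: (F_between (s1 := s) (s3 := 0)) => //.
  by apply/andP; split; lra.
- move: m1; rewrite ltNge => /negP; apply; apply: (F_between (s1 := 0) (s3 := s)) => //.
  by apply/andP; split; lra.
Qed.

Lemma compact_preimage_strip (K : set (H1 R)) (A B : R) : compact K ->
  compact [set w | K (F w) /\ w.2 \in `[A, B]].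
Proof.
move=> cK.
have [M [_ MK]] := compact_bounded cK.
have {}MK x : K x -> `|x| <= M + 1 by apply: MK; rewrite ltrDl.
have /compact_near_coveringP/(_ R (pinfty_nbhs R)
    (fun S t => forall s, `|F (s, t)| <= M + 1 -> `|s| <= S)) := @segment_compact R A B.
case=> [t _|S [_ hS]]; first exact: ruling_sublevel_near.
have clK : closed K by apply: compact_closed => //; exact: norm_hausdorff.
have cI := compact_setX (@segment_compact R (- (S + 1)) (S + 1)) (@segment_compact R A B).
apply: (subclosed_compact _ cI).
  rewrite (_ : [set w | _] = F @^-1` K `&` snd @^-1` `[A, B]%classic)//.
  apply: closedI; apply: closed_comp => //.
  - by move=> x _; exact: cvg_snd.
  - exact: itv_closed.
move=> [s t] [/= /MK Fst tAB]; split=> //=.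
have := hS (S + 1) _ t tAB s Fst; rewrite ltrDl ltr01 => /(_ isT).
by rewrite ler_norml in_itv.
Qed.

End CompactPreimages.

(** * Properness *)

Section Properness.
Variable R : realType.

Section Parametrization.
Variables (T : topologicalType) (e : R -> T) (X : R * T -> H1 R).

Let F := X \o Defs.cover e.

Hypothesis e_surj : forall theta, exists t, e t = theta.
Hypothesis e_deck : forall t1 t2 t, e t1 = e t2 -> e (t + (t1 - t2)) = e t.
Hypothesis surf : ruled_p_minimal_immersion e X.
Hypothesis complete : complete_surface e X.

Lemma complete_ruled_compact_preimage (K : set (H1 R)) (A B : R) : compact K ->
  compact [set w | K (F w) /\ w.2 \in `[A, B]].
Proof.
case: surf => [[C1F _] immF _ rul].
have param t : exists p v a, v != 0 /\ ruling_param F t p v a.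
  have [L [leg _] XL] := rul (e t).
  by apply: (ruling_paramP C1F immF leg) => s; apply: XL; exists s.
apply: compact_preimage_strip.
- by move=> w; apply: differentiable_continuous; exact: C1F.1.
- move=> t s1 s2 s3 M; have [p [v [a [_ ra]]]] := param t.
  exact: ruling_param_between ra.
- move=> t sg M sg1; have [p [v [a [v0 ra]]]] := param t.
  exact: (complete_ruling_unbounded e_surj e_deck C1F M immF complete v0 ra sg1).
Qed.

End Parametrization.

Lemma circle_angle_onto (theta : S1 R) :
  exists2 t, t \in `[- pi, pi] & circle_angle t = theta.
Proof.
case: theta => -[x y] xyP.
have xy1 : x ^+ 2 + y ^+ 2 = 1 by move: xyP; rewrite inE.
have x1 : -1 <= x <= 1.
  rewrite -ler_norml -(@ler_sqr _ `|x| 1) ?nnegrE// expr1n real_normK ?num_real//.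
  by rewrite -xy1 lerDl sqr_ge0.
have cx : cos (acos x) = x by apply: acosK; rewrite in_itv.
have sx : sin (acos x) = `|y|.
  by rewrite sin_acos// -xy1 addrAC subrr add0r sqrtr_sqr.
have a0 := acos_ge0 x1; have api := acos_lepi x1; have p0 := pi_ge0 R.
have [y0|y0] := leP 0 y.
  exists (acos x); first by rewrite in_itv/= api (le_trans _ a0)// oppr_le0.
  by apply/val_inj; rewrite /= cx sx ger0_norm.
exists (- acos x); first by rewrite in_itv/= lerN2 api (le_trans _ p0)// oppr_le0.
by apply/val_inj; rewrite /= cosN sinN cx sx ltr0_norm// opprK.
Qed.

(** The difference of two angles that give the same point has cosine 1 and
sine 0. *)
Lemma circle_angle_deck (t1 t2 t : R) : circle_angle t1 = circle_angle t2 ->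
  circle_angle (t + (t1 - t2)) = circle_angle t.
Proof.
move=> [c12 s12]; have d : cos (t1 - t2) = 1 /\ sin (t1 - t2) = 0.
  rewrite cosB sinB c12 s12 -!expr2 cos2Dsin2; split=> //; ring.
by apply/val_inj; rewrite /= (cosD t) (sinD t) d.1 d.2; congr pair; ring.
Qed.

Lemma continuous_circle_angle : continuous (@circle_angle R).
Proof.
apply: (@continuous_comp_initial _ _ _ set_val).
move=> t; have : {for t, continuous (fun t => (cos t, sin t) : R * R)}.
  apply: differentiable_continuous; apply: differentiable_pair.
    by apply/derivable1_diffP; exact: ex_derive.
  by apply/derivable1_diffP; exact: ex_derive.
exact.
Qed.

Lemma ruling_dist_le (X : R * R -> H1 R) (s t : R) :
  ruling_dist X t <= 2 * `|X (s, t)|.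
Proof.
apply: le_trans (eucl_norm_le _); apply: ge_inf.
  by exists 0 => _ [p _ <-]; exact: sqrtr_ge0.
by exists (X (s, t)) => //; exists s.
Qed.

Lemma ruling_dist_ge (X : R * R -> H1 R) (t M : R) :
  (forall s, M <= `|X (s, t)|) -> M <= ruling_dist X t.
Proof.
move=> XM; apply: lb_le_inf.
  by exists (eucl_norm (X (0, t))); exists (X (0, t)) => //; exists 0.
by move=> _ [p [s _ <-] <-]; exact: le_trans (XM s) (norm_le_eucl_norm _).
Qed.
End Properness.

Theorem proposition4p1 (R : realType) :
  (forall X : R * S1 R -> H1 R,
     ruled_p_minimal_immersion (@circle_angle R) X ->
     complete_surface (@circle_angle R) X ->
     proper_surface X) /\
  (forall X : R * R -> H1 R,
     ruled_p_minimal_immersion (@id R) X ->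
     complete_surface (@id R) X ->
     (proper_surface X <->
      ruling_dist X t @[t --> -oo] --> +oo /\
      ruling_dist X t @[t --> +oo] --> +oo)).
Proof.
split=> X surf complete.
  have onto (theta : S1 R) : exists t, circle_angle t = theta.
    by have [t _ te] := circle_angle_onto theta; exists t.
  move=> K cK.
  have cS := complete_ruled_compact_preimage onto (@circle_angle_deck R) surf complete
    (A := - pi) (B := pi) cK.
  rewrite (_ : X @^-1` K = Defs.cover (@circle_angle R) @`
      [set w | K ((X \o Defs.cover (@circle_angle R)) w) /\ w.2 \in `[- pi, pi]]).
    apply: continuous_compact cS; apply: continuous_subspaceT => w.
    have c1 : u.1 @[u --> w] --> w.1 by exact: cvg_fst.
    have c2 : circle_angle u.2 @[u --> w] --> circle_angle w.2.
      exact: (@cvg_comp _ _ _ snd (@circle_angle R) _ _ _ cvg_snd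
        (@continuous_circle_angle R w.2)).
    exact: (cvg_pair c1 c2).
  apply/seteqP; split=> [[s theta] /= KX|_ [w [Kw _] <-]//].
  by have [t tI te] := circle_angle_onto theta; exists (s, t); rewrite /Defs.cover ?te.
have onto (t : R) : exists u, id u = t by exists t.
have deck (t1 t2 t : R) : id t1 = id t2 -> id (t + (t1 - t2)) = id t.
  by move=> /= ->; rewrite subrr addr0.
have XE : X \o Defs.cover id = X by apply/funext => -[].
have strip K A B := complete_ruled_compact_preimage onto deck surf complete
  (K := K) (A := A) (B := B).
split=> [pX|[lN lP] K cK].
  have bnd A : exists T, forall s t, T < `|t| -> A <= `|X (s, t)|.
    have cK : compact [set p : H1 R | `|p| <= A].
      apply: bounded_closed_compact.
        by exists A; split=> [|M AM p /= pA]; [exact: num_real|rewrite (le_trans pA)// ltW].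
      rewrite (_ : [set _ | _] = Num.norm @^-1` [set x : R | x <= A])//.
      apply: closed_comp; last exact: closed_le.
      by move=> x _; exact: norm_continuous.
    have [M [_ hM]] := compact_bounded (pX _ cK).
    exists (M + 1) => s t Mt; rewrite leNgt; apply/negP => XA.
    have M1 : M < M + 1 by rewrite ltrDl.
    have /= := hM _ M1 (s, t) (ltW XA).
    by rewrite prod_normE ge_max /= => /andP[_]; rewrite leNgt Mt.
  split; apply/cvgryPge => A; have [T hT] := bnd A.
    near=> t; apply: ruling_dist_ge => s; apply: hT.
    rewrite ltr_normr; apply/orP; right; rewrite ltrNr; near: t.
    exact: nbhs_ninfty_lt (num_real _).
  near=> t; apply: ruling_dist_ge => s; apply: hT.
  rewrite ltr_normr; apply/orP; left; near: t.
  exact: nbhs_pinfty_gt (num_real _).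
have [M [_ MK]] := compact_bounded cK.
have {}MK x : K x -> `|x| <= M + 1 by apply: MK; rewrite ltrDl.
(* the Euclidean norm is at most twice the sup norm *)
have far t : 2 * (M + 1) < ruling_dist X t -> forall s, ~ K (X (s, t)).
  move=> rt s /MK XM; move: rt; rewrite ltNge => /negP; apply.
  by apply: (le_trans (ruling_dist_le X s t)); rewrite ler_pM2l.
have /cvgryPgt/(_ (2 * (M + 1)))[A [_ hA]] := lN.
have /cvgryPgt/(_ (2 * (M + 1)))[B [_ hB]] := lP.
have := strip K A B cK; rewrite XE.
congr compact; apply/seteqP; split=> [w [] //|[s t] /= KX]; split=> //.
rewrite in_itv/=; apply/andP; split; rewrite leNgt; apply/negP => h.
  by apply: (far t _ s KX); exact: hA.
by apply: (far t _ s KX); exact: hB.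
Unshelve. all: by end_near.
Qed.
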